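(* For $n\ge 2$ and $1\le d\le n-1$ let $$g_{n,d}(1)=\sum_{i=1}^{\min(d,n-d)}\binom{n-i-1}{d-i}\binom{n-d-1}{i-1}.$$ For $n\ge 4$, the sequence $\{g_{n,d}(1)\}_{d=1}^{n-1}$ is infinitely log-concave. For $n\ge 5$, the sequence $\{g_{n,d}(1)\}_{d=1}^{n-1}$ satisfies the higher order Turán inequality, i.e. for $2\le d\le n-3$, $$4\big(a_d^2-a_{d-1}a_{d+1}\big)\big(a_{d+1}^2-a_da_{d+2}\big)\ge\big(a_da_{d+1}-a_{d-1}a_{d+2}\big)^2,\quad a_d:=g_{n,d}(1).$$
   Context: $g_{n,d}(1)$ is the value at $t=1$ of Speyer's $g$-polynomial of the uniform matroid $U_{n,d}$. For a real sequence $\{a_k\}$ (a finite sequence being extended by zeros outside its index range), define $\mathfrak{L}(\{a_k\})=\{a_k^2-a_{k-1}a_{k+1}\}$; the sequence is infinitely log-concave if $\mathfrak{L}^j(\{a_k\})$ is nonnegative for every $j\ge1$. *)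

(* Defs.v *)
From mathcomp Require Import all_boot all_order all_algebra.
From mathcomp Require Import reals.
Set Implicit Arguments.
Unset Strict Implicit.
Unset Printing Implicit Defensive.
Import GRing.Theory Num.Theory.
Local Open Scope ring_scope.

(* g_{n,d}(1); for 1 <= d <= n-1 and i in the summation range, none of the
   subtractions is truncated. *)
Definition g1 (n d : nat) : nat :=
  (\sum_(1 <= i < (minn d (n - d)).+1)
     'C(n - i - 1, d - i) * 'C(n - d - 1, i - 1))%N.

Definition zero_ext (R : realType) (lo hi : nat) (a : nat -> R) (k : int) : R :=
  if k is Posz m then (if (lo <= m <= hi)%N then a m else 0) else 0.

Definition Lop (R : realType) (a : int -> R) (k : int) : R :=
  a k ^+ 2 - a (k - 1) * a (k + 1).

Definition inf_log_concave (R : realType) (a : int -> R) : Prop :=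
  forall (j : nat) (k : int), (1 <= j)%N -> 0 <= iter j (@Lop R) a k.

(* Main.v *)
Require Import Defs.
From mathcomp Require Import all_boot all_order all_algebra.
From mathcomp Require Import reals complex ring lra zify.
Import Order.TTheory GRing.Theory Num.Theory.
Set Implicit Arguments.
Unset Strict Implicit.
Local Open Scope ring_scope.
Local Notation Re := complex.Re.
Local Notation Im := complex.Im.

(* The numbers [g1 (m + 2) (k + 1)] are the coefficients of polynomials with
   [P_(m+2) = (1 + X) P_(m+1) + X P_m]. For [Re w > 0] the ratio
   [P_(m+1)(w^2) / (w P_m(w^2))] stays in the right half-plane, so every root of
   [P_m] is a negative real.

   Infinite log-concavity is Branden's theorem: [L] preserves polynomials
   [c * prod (1 + r X)] with [c, r > 0]. With [x_j = r_j w], the transform at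
   [w^2] is the coefficient of [u^n] in [(1 - u^2) prod (1 + x_j u) (u + x_j)],
   that is, up to a nonzero factor, in [(1 - u^2) prod (u + z_j (1 + u^2))] with
   [z_j = (x_j + 1/x_j)^-1] in the right half-plane. By the Grace-Walsh-Szego
   theorem (iterated Laguerre polar derivatives) it is nonzero as soon as this
   holds when all [z_j] coincide; that case is a Narayana polynomial, which is
   real-rooted by Rodrigues' formula and Gauss-Lucas.

   The same method shows that the cubic with coefficients
   [a_(d-1), 3 a_d, 3 a_(d+1), a_(d+2)] is real-rooted; the higher order Turan
   inequality says that its discriminant is nonnegative. *)

(** * Laguerre's theorem for the right half-plane *)

Section HalfPlane.
Variable R : rcfType.
Local Notation C := R[i].
Implicit Types (z w : C) (f : {poly C}).

Lemma Re_sum (I : Type) (s : seq I) (F : I -> C) :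
  Re (\sum_(i <- s) F i) = \sum_(i <- s) Re (F i).
Proof. by apply: (big_morph (@Re R)) => // -[? ?] [? ?]. Qed.

Lemma Im_sum (I : Type) (s : seq I) (F : I -> C) :
  Im (\sum_(i <- s) F i) = \sum_(i <- s) Im (F i).
Proof. by apply: (big_morph (@Im R)) => // -[? ?] [? ?]. Qed.

Lemma Re_add z w : Re (z + w) = Re z + Re w. Proof. by case: z w => [? ?] []. Qed.
Lemma Im_add z w : Im (z + w) = Im z + Im w. Proof. by case: z w => [? ?] []. Qed.
Lemma Re_opp z : Re (- z) = - Re z. Proof. by case: z. Qed.
Lemma Im_opp z : Im (- z) = - Im z. Proof. by case: z. Qed.
Lemma Re_mul z w : Re (z * w) = Re z * Re w - Im z * Im w.
Proof. by case: z w => [? ?] []. Qed.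
Lemma Im_mul z w : Im (z * w) = Re z * Im w + Im z * Re w.
Proof. by case: z w => [? ?] [? ?] /=; ring. Qed.

Lemma sqr_ReIm_gt0 z : z != 0 -> 0 < Re z ^+ 2 + Im z ^+ 2.
Proof.
rewrite eq_complex /= => zN0.
rewrite lt_neqAle addr_ge0 ?sqr_ge0 // andbT eq_sym.
by rewrite paddr_eq0 ?sqr_ge0 // !sqrf_eq0.
Qed.

Lemma Re_inv z : Re z^-1 = Re z / (Re z ^+ 2 + Im z ^+ 2). Proof. by case: z. Qed.
Lemma Im_inv z : Im z^-1 = - (Im z / (Re z ^+ 2 + Im z ^+ 2)).
Proof. by case: z. Qed.

Lemma Re_neq0 z : Re z != 0 -> z != 0.
Proof. by apply: contraNneq => ->. Qed.

Lemma Im_neq0 z : Im z != 0 -> z != 0.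
Proof. by apply: contraNneq => ->. Qed.

Lemma Re_inv_gt0 z : 0 < Re z -> 0 < Re z^-1.
Proof.
move=> z_gt0; rewrite Re_inv divr_gt0 // sqr_ReIm_gt0 // Re_neq0 //.
by rewrite gt_eqF.
Qed.

Lemma horner_deriv_prod_XsubC (F : fieldType) (s : seq F) (z : F) :
  (\prod_(w <- s) ('X - w%:P)).[z] != 0 ->
  (\prod_(w <- s) ('X - w%:P))^`().[z] =
    (\prod_(w <- s) ('X - w%:P)).[z] * \sum_(w <- s) (z - w)^-1.
Proof.
elim: s => [|w s IH]; first by rewrite !big_nil derivC horner0 mulr0.
rewrite !big_cons hornerM hornerXsubC mulf_eq0 negb_or => /andP[zw sN0].
rewrite derivM derivXsubC mul1r hornerD hornerM hornerXsubC IH // .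
by rewrite mulrDr mulrAC divff // mul1r mulrA.
Qed.

(* [v = (z - w)^-1] lies in the disc [Re z * |v|^2 <= Re v]; this consequence
   is affine in [v], hence can be summed over the roots [w] of a polynomial. *)
Lemma disc_supporting_line z w (v0 : C) : 0 < Re z -> Re w <= 0 ->
  0 <= Re (z - w)^-1
       - 2 * Re z * (Re (z - w)^-1 * Re v0 + Im (z - w)^-1 * Im v0)
       + Re z * (Re v0 ^+ 2 + Im v0 ^+ 2).
Proof.
move=> z_gt0 w_le0; set v := (z - w)^-1.
have zwN0 : z - w != 0.
  by apply: Re_neq0; rewrite Re_add Re_opp gt_eqF // subr_gt0 (le_lt_trans w_le0).
have vK : (z - w) * v = 1 by rewrite divff.
have disc : Re z * (Re v ^+ 2 + Im v ^+ 2) <= Re v.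
  have Ev : Re v = (Re z - Re w) * (Re v ^+ 2 + Im v ^+ 2).
    have := congr1 (@Re R) vK; have := congr1 (@Im R) vK.
    rewrite Re_mul Im_mul !Re_add !Re_opp !Im_add !Im_opp /= => eI eR; rewrite !expr2.
    transitivity (Re v * ((Re z - Re w) * Re v - (Im z - Im w) * Im v)
      + Im v * ((Re z - Re w) * Im v + (Im z - Im w) * Re v)); last by ring.
    by rewrite eI eR; ring.
  by rewrite [leRHS]Ev; apply: ler_wpM2r; [rewrite addr_ge0 ?sqr_ge0 | rewrite lerBrDr gerDl].
have := sqr_ge0 (Re v - Re v0); have := sqr_ge0 (Im v - Im v0).
rewrite !expr2 in disc *; nra.
Qed.

(** If the expression vanished, [(z - zeta)^-1] would be the mean of the [(z - w)^-1] over the roots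
    [w], padded with zeros to [n.+1] terms. All these points lie in the disc [Re z * |v|^2 <= Re v],
    whereas [(z - zeta)^-1] lies outside it. *)
Theorem laguerre_half_plane f (n : nat) :
  (size f <= n.+2)%N -> (forall z, 0 < Re z -> f.[z] != 0) ->
  forall z zeta : C, 0 < Re z -> 0 < Re zeta ->
    n.+1%:R * f.[z] - (z - zeta) * f^`().[z] != 0.
Proof.
move=> size_f fN0 z zeta z_gt0 zeta_gt0; apply/negP; rewrite subr_eq0 => /eqP E.
have [s Ef] := closed_field_poly_normal f.
have f0 : f != 0 by apply: contraNneq (fN0 z z_gt0) => ->; rewrite horner0.
have size_s : (size s <= n.+1)%N.
  by move: size_f; rewrite Ef size_scale ?lead_coef_eq0 // size_prod_XsubC.
have s_le0 w : w \in s -> Re w <= 0.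
  move=> ws; rewrite leNgt; apply/negP => /fN0; apply/negP/negPn.
  by rewrite Ef hornerZ -[X in _ * X == _]/(horner _ _) mulf_eq0;
    apply/orP; right; rewrite -/(root _ _) root_prod_XsubC.
have Ed : f^`().[z] = f.[z] * \sum_(w <- s) (z - w)^-1.
  rewrite Ef derivZ !hornerZ horner_deriv_prod_XsubC ?mulrA //.
  by have := fN0 z z_gt0; rewrite {1}Ef hornerZ mulf_eq0 negb_or => /andP[].
have zzN0 : z - zeta != 0.
  apply: contra_eq_neq E => ->; rewrite mul0r mulf_neq0 ?fN0 //.
  by rewrite pnatr_eq0.
set v0 := (z - zeta)^-1.
have Ev0 : \sum_(w <- s) (z - w)^-1 = n.+1%:R * v0.
  have : (z - zeta) * f.[z] != 0 by rewrite mulf_neq0 // fN0.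
  by move/mulfI; apply; rewrite -[LHS]mulrA -Ed -E /v0; field.
have natC : n.+1%:R = (n.+1%:R : R)%:C%C :> C by rewrite rmorph_nat.
have sumR : \sum_(w <- s) Re (z - w)^-1 = n.+1%:R * Re v0.
  by rewrite -Re_sum Ev0 natC Re_mul /= mul0r subr0.
have sumI : \sum_(w <- s) Im (z - w)^-1 = n.+1%:R * Im v0.
  by rewrite -Im_sum Ev0 natC Im_mul /= mul0r addr0.
have v0K : (z - zeta) * v0 = 1 by rewrite divff.
set q := Re v0 ^+ 2 + Im v0 ^+ 2.
have q_gt0 : 0 < q by rewrite sqr_ReIm_gt0 // invr_eq0.
have out : Re v0 < Re z * q.
  have -> : Re v0 = (Re z - Re zeta) * q.
    have := congr1 (@Re R) v0K; have := congr1 (@Im R) v0K.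
    rewrite Re_mul Im_mul !Re_add !Re_opp !Im_add !Im_opp /= => eI eR; rewrite /q !expr2.
    transitivity (Re v0 * ((Re z - Re zeta) * Re v0 - (Im z - Im zeta) * Im v0)
      + Im v0 * ((Re z - Re zeta) * Im v0 + (Im z - Im zeta) * Re v0));
      last by ring.
    by rewrite eI eR; ring.
  by rewrite ltr_pM2r // gtrBl.
(* With [A = Re z * q], [N = n.+1] and [d = size s], this sum is [N * Re v0 - 2 * N * A + d * A],
   which is negative because [Re v0 < A] and [d <= N]. *)
have : 0 <= \sum_(w <- s) (Re (z - w)^-1
    - 2 * Re z * (Re (z - w)^-1 * Re v0 + Im (z - w)^-1 * Im v0) + Re z * q).
  by rewrite big_seq; apply: sumr_ge0 => w /s_le0; apply: disc_supporting_line.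
rewrite big_split sumrB /= -mulr_sumr big_split /= -!mulr_suml sumR sumI.
rewrite big_const_seq count_predT iter_addr_0 -[_ *+ size s]mulr_natl.
have : (size s)%:R <= n.+1%:R :> R by rewrite ler_nat.
have : 0 < n.+1%:R :> R by rewrite ltr0n.
have : 0 < Re z * q by rewrite mulr_gt0.
rewrite /q !expr2 in out *.
set N : R := n.+1%:R; set d : R := _%:R; set A := Re z * _ in out * => A0 N0 dN.
rewrite leNgt; apply/negP; rewrite negbK.
have -> : 2 * Re z * (N * Re v0 * Re v0 + N * Im v0 * Im v0) = 2 * N * A.
  by rewrite /A; ring.
have h1 : N * (Re v0 - A) < 0 by rewrite pmulr_rlt0 // subr_lt0.
have h2 : (N - d) * A >= 0 by rewrite mulr_ge0 ?subr_ge0 // ltW.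
rewrite -[d * _ * _]mulrA -/A; lra.
Qed.

End HalfPlane.

(** * The Grace-Walsh-Szego theorem for a coefficient of a product *)

Section GraceWalshSzego.
Variable R : rcfType.
Local Notation C := R[i].
Variables (a b : {poly C}) (m : nat).
Implicit Types h : {poly C}.

(** Diagonal restriction of the symmetric multiaffine form that sends z_1, ..., z_n to the
    coefficient of index [m] in [h] times the product of the [a + z_i *: b]. *)
Definition diag_poly h n : {poly C} :=
  \poly_(k < n.+1) ((h * a ^+ (n - k) * b ^+ k)`_m *+ 'C(n, k)).

Lemma horner_diag_poly h n z :
  (diag_poly h n).[z] = (h * (a + z *: b) ^+ n)`_m.
Proof.
rewrite horner_poly exprDn mulr_sumr coef_sum; apply: eq_bigr => k _.
rewrite exprZn mulrnAr coefMn mulrnAl -scalerAr -scalerAr coefZ mulrA.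
by rewrite mulrC.
Qed.

Lemma deriv_diag_poly h n :
  (diag_poly h n.+1)^`() = n.+1%:R *: diag_poly (h * b) n.
Proof.
apply/polyP => k; rewrite coef_deriv coefZ !coef_poly ltnS.
case: ltnP => [le_kn|]; last by rewrite mul0rn mulr0.
rewrite subSS -mulrnA mulnC -mul_bin_diag mulr_natl -mulrnA mulnC.
suff -> : h * a ^+ (n - k) * b ^+ k.+1 = h * b * a ^+ (n - k) * b ^+ k by [].
by rewrite exprS; ring.
Qed.

(** The polar derivative of [diag_poly h n.+1] at [zeta] is, up to the factor [n.+1], the diagonal
    form in [n] variables for [h * (a + zeta *: b)]. Each induction step thus freezes one variable
    at [zeta], and Laguerre's theorem keeps the diagonal nonzero. *)
Theorem grace_walsh_szego (s : seq C) h :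
  (forall z, 0 < Re z -> (h * (a + z *: b) ^+ size s)`_m != 0) ->
  (forall z, z \in s -> 0 < Re z) ->
  (h * \prod_(z <- s) (a + z *: b))`_m != 0.
Proof.
elim: s h => [|zeta s IH] h diagN0 s_gt0.
  by have := diagN0 1; rewrite big_nil expr0; apply; rewrite /= ltr01.
rewrite big_cons mulrA; apply: IH => [z z_gt0|z zs]; last first.
  by apply: s_gt0; rewrite in_cons zs orbT.
have size_f : (size (diag_poly h (size s).+1) <= (size s).+2)%N.
  exact: size_poly.
have fN0 z' : 0 < Re z' -> (diag_poly h (size s).+1).[z'] != 0.
  by move=> /diagN0; rewrite horner_diag_poly.
have zeta_gt0 : 0 < Re zeta by apply: s_gt0; rewrite mem_head.
have := laguerre_half_plane size_f fN0 z_gt0 zeta_gt0.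
rewrite deriv_diag_poly hornerZ !horner_diag_poly mulrCA -mulrBr.
rewrite mulf_eq0 negb_or => /andP[_].
rewrite -coefZ -coefB.
suff -> : h * (a + zeta *: b) * (a + z *: b) ^+ size s =
  h * (a + z *: b) ^+ (size s).+1
    - (z - zeta) *: (h * b * (a + z *: b) ^+ size s) by [].
by rewrite exprS -!mul_polyC polyCB; ring.
Qed.

End GraceWalshSzego.

(** * Real-rootedness and Jacobi polynomials *)

Section RealRooted.
Variable R : rcfType.
Local Notation C := R[i].
Implicit Types f : {poly C}.

(** The zero polynomial belongs to the class, so that it is stable under derivation, constants
    included. *)
Definition real_rooted f := forall z, Im z != 0 -> f.[z] = 0 -> f = 0.

(* Gauss-Lucas *)
Lemma real_rooted_deriv f : real_rooted f -> real_rooted f^`().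
Proof.
move=> rf z zN0 f'z.
have [->|f0] := eqVneq f 0; first exact: derivC.
have fz : f.[z] != 0 by apply: contra_neq f0; apply: rf.
have [s Ef] := closed_field_poly_normal f.
have s_real w : w \in s -> Im w = 0.
  move=> ws; apply/eqP; apply: contraNT f0 => /rf -> //.
  apply/eqP; rewrite Ef hornerZ mulf_eq0.
  by apply/orP; right; rewrite -/(root _ _) root_prod_XsubC.
case: s Ef s_real => [|w s] Ef s_real.
  by rewrite Ef big_nil derivZ derivC scaler0.
have : \sum_(w <- w :: s) (z - w)^-1 = 0.
  apply: (mulfI fz); rewrite mulr0 -[RHS]f'z Ef derivZ !hornerZ.
  rewrite horner_deriv_prod_XsubC ?mulrA //.
  by move: fz; rewrite Ef hornerZ mulf_eq0 negb_or => /andP[].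
(* As [w'] is real, [Im (z - w')^-1] has the sign opposite to [Im z], so the terms of the
   logarithmic derivative cannot cancel. *)
have term w' : w' \in w :: s -> 0 < Im z * - Im (z - w')^-1.
  move=> /s_real w'0; rewrite Im_inv opprK mulrA Im_add Im_opp w'0 subr0 -expr2.
  rewrite divr_gt0 ?exprn_even_gt0 //= ltr_wpDl ?sqr_ge0 //.
  by rewrite exprn_even_gt0.
move/(congr1 (fun x => Im z * - Im x)); rewrite Im_sum /= oppr0 mulr0.
move/eqP; rewrite -sumrN mulr_sumr gt_eqF //.
rewrite big_cons ltr_wpDr ?term ?mem_head //.
by rewrite big_seq sumr_ge0 // => x xs; rewrite ltW // term // in_cons xs orbT.
Qed.

Lemma real_rooted_nderivn f n : real_rooted f -> real_rooted f^`N(n).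
Proof.
move=> rf; have : real_rooted f^`(n).
  by elim: n => [//|n IH]; rewrite derivnS; apply: real_rooted_deriv.
move=> rn z zN0 fz; have := rn z zN0.
rewrite nderivn_def hornerMn fz mul0rn => /(_ erefl) /eqP.
by rewrite -mulr_natr mulf_eq0 -polyC_natr polyC_eq0 pnatr_eq0
  gtn_eqF ?fact_gt0 // orbF => /eqP.
Qed.

Lemma real_rooted_jacobi a b : real_rooted ('X^a * (1 - 'X) ^+ b).
Proof.
move=> z zN0; rewrite hornerM !horner_exp !hornerE => /eqP.
rewrite mulf_eq0 !expf_eq0 subr_eq0 => /orP[]/andP[_ /eqP E].
  by rewrite E eqxx in zN0.
by rewrite -E eqxx in zN0.
Qed.

Lemma coef_exp_XaddC (F : comNzRingType) (c d : F) n i : 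
  ((c%:P + d *: 'X) ^+ n)`_i = c ^+ (n - i) * d ^+ i *+ 'C(n, i).
Proof.
rewrite exprDn coef_sum.
under eq_bigr => j _ do
  rewrite exprZn -rmorphXn /= -scalerAr coefMn coefZ coefCM coefXn.
have [le_in|lt_ni] := leqP i n; last first.
  rewrite bin_small // mulr0n big1 // => j _.
  by rewrite gtn_eqF ?(leq_trans (ltn_ord j)) // !mulr0 mul0rn.
rewrite (bigD1 (Ordinal (le_in : (i < n.+1)%N))) //= eqxx mulr1 big1 ?addr0.
  by rewrite mulrC.
move=> j; rewrite -val_eqE /= eq_sym => /negbTE ->.
by rewrite !mulr0 mul0rn.
Qed.

Lemma coef_comp_XaddC (F : comNzRingType) (p : {poly F}) y i :
  (p \Po (y%:P + 'X))`_i = p^`N(i).[y].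
Proof.
rewrite /comp_poly nderiv_taylor; last exact: mulrC.
rewrite coef_sum.
under eq_bigr => j _ do
  rewrite nderivn_map horner_map /= coefCM coefXn.
have [lt_ip|le_pi] := ltnP i (size p^:P).
  rewrite (bigD1 (Ordinal lt_ip)) //= eqxx mulr1 big1 ?addr0 // => j.
  by rewrite -val_eqE /= eq_sym => /negbTE ->; rewrite mulr0.
rewrite nderivn_poly0 ?horner0; last by rewrite -(size_map_polyC p).
by rewrite big1 // => j _; rewrite gtn_eqF ?(leq_trans (ltn_ord j)) // mulr0.
Qed.

(** For [t = (y - 1) / y] and [c <= b], multiplying by [y ^+ (b - c)] gives the Jacobi polynomial of
    index [b - c] with parameters [c] and [a - b + c] (in the integers), at [2 * y - 1]. *)
Definition jacobi_sum (F : pzSemiRingType) a b c (t : F) :=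
  \sum_(i < a.+1) t ^+ i *+ ('C(a, i) * 'C(b, c + i)).

Lemma jacobi_sum_gt0 (F : numDomainType) a b c (t : F) :
  (c <= b)%N -> 0 <= t -> 0 < jacobi_sum a b c t.
Proof.
move=> le_cb t_ge0; rewrite /jacobi_sum big_ord_recl ltr_wpDr //.
  by apply: sumr_ge0 => i _; rewrite mulrn_wge0 // exprn_ge0.
by rewrite /= expr0 bin0 mul1n addn0 ltr0n bin_gt0.
Qed.

(* Rodrigues' formula *)
Lemma nderivn_jacobi (F : fieldType) a b c (y : F) : y != 0 -> (c <= b)%N ->
  ('X^a * (1 - 'X) ^+ b)^`N(b - c).[y] =
    (-1) ^+ (b - c) * (1 - y) ^+ c * y ^+ a * jacobi_sum a b c ((y - 1) / y).
Proof.
move=> y0 le_cb; rewrite -coef_comp_XaddC.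
have -> : ('X^a * (1 - 'X) ^+ b) \Po (y%:P + 'X)
    = (y%:P + 1 *: 'X) ^+ a * ((1 - y)%:P + (-1) *: 'X) ^+ b.
  rewrite rmorphM !rmorphXn /= rmorphB /= comp_polyX comp_polyC scale1r.
  by rewrite scaleN1r polyCB opprD addrA.
rewrite coefM /jacobi_sum mulr_sumr.
under eq_bigr => i _ do rewrite !coef_exp_XaddC expr1n mulr1.
pose G i := (y ^+ (a - i) *+ 'C(a, i)) *
  ((1 - y) ^+ (b - (b - c - i)) * (-1) ^+ (b - c - i) *+ 'C(b, b - c - i)).
pose G' i := (-1) ^+ (b - c) * (1 - y) ^+ c * y ^+ a
  * (((y - 1) / y) ^+ i *+ ('C(a, i) * 'C(b, c + i))).
rewrite -(big_mkord xpredT G) -(big_mkord xpredT G').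
(* Leibniz' rule sums up to [b - c], [jacobi_sum] up to [a]; both are extended to a common bound by
   terms with a zero binomial. *)
pose M := (a + b).+1.
have trunc n (H : nat -> F) : (n < M)%N -> (forall i, (n < i)%N -> H i = 0) ->
    \sum_(0 <= i < n.+1) H i = \sum_(0 <= i < M) H i.
  move=> lt_nM H0; rewrite [RHS](big_cat_nat (n := n.+1)) //=.
  by rewrite [X in _ + X]big_nat_cond [X in _ + X]big1 ?addr0 // => i
    /andP[/andP[/H0]].
have G'0 i : (a < i)%N || (b - c < i)%N -> G' i = 0.
  rewrite /G' => /orP[lt_i|lt_i]; first by rewrite bin_small // mulr0n mulr0.
  have -> : 'C(b, c + i) = 0%N by apply: bin_small; lia.
  by rewrite muln0 mulr0n mulr0.
have GG' i : (i <= b - c)%N -> G i = G' i.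
  move=> le_i; have [lt_ai|le_ia] := ltnP a i.
    by rewrite G'0 ?lt_ai // /G bin_small // mulr0n mul0r.
  rewrite /G /G' -['C(b, b - c - i)]bin_sub; last by lia.
  have -> : (b - (b - c - i) = c + i)%N by lia.
  rewrite -[in RHS]mulr_natr natrM -[y ^+ _ *+ _]mulr_natr -[_ *+ 'C(b, _)]mulr_natr.
  have -> : (-1) ^+ (b - c - i) = (-1) ^+ (b - c) * (-1) ^+ i :> F.
    rewrite -{2}(subnK le_i) exprD -mulrA -expr2 -exprM mulnC exprM sqrrN !expr1n.
    by rewrite mulr1.
  have -> : ((y - 1) / y) ^+ i = (-1) ^+ i * (1 - y) ^+ i * y ^- i.
    by rewrite -exprMn mulN1r opprB expr_div_n.
  have -> : y ^+ a = y ^+ (a - i) * y ^+ i by rewrite -exprD subnK.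
  rewrite exprD.
  have := expf_neq0 i y0; move: (y ^+ i) => yi yi0; field.
  by [].
have -> : \sum_(0 <= i < (b - c).+1) G i = \sum_(0 <= i < (b - c).+1) G' i.
  by rewrite !big_nat; apply: eq_bigr => i; rewrite ltnS => /GG'.
by rewrite !trunc ?/M //; try lia; move=> i lt_i; rewrite G'0 // lt_i ?orbT.
Qed.

(** The substitution [y = (1 - t)^-1] solves [(y - 1) / y = t] and preserves non-reality. A zero [t]
    would make the real-rooted derivative in Rodrigues' formula vanish at [y], hence identically. *)
Lemma jacobi_sum_neq0 a b c (t : C) : (c <= b)%N -> Im t != 0 ->
  jacobi_sum a b c t != 0.
Proof.
move=> le_cb tN0; apply/eqP => J0.
have t1 : 1 - t != 0 by apply: Im_neq0; rewrite Im_add Im_opp /= sub0r oppr_eq0.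
pose y := (1 - t)^-1.
have y0 : y != 0 by rewrite invr_eq0.
have yt : (y - 1) / y = t by rewrite /y; field.
have rr : real_rooted (('X^a * (1 - 'X) ^+ b : {poly C})^`N(b - c)).
  by apply: real_rooted_nderivn; apply: real_rooted_jacobi.
have yN0 : Im y != 0.
  rewrite Im_inv Im_add Im_opp /= sub0r mulNr opprK mulf_eq0 negb_or tN0 invr_eq0 /=.
  by have := sqr_ReIm_gt0 t1; rewrite Re_add Re_opp Im_add Im_opp /= sub0r => /gt_eqF->.
have D0 := rr y yN0; rewrite nderivn_jacobi // yt J0 mulr0 in D0.
have n1 : -1 != 0 :> C by rewrite oppr_eq0 oner_eq0.
(* The derivative is not identically zero: at [y = -1] the argument of [jacobi_sum] is 2, where the
   sum is positive. *)
have := nderivn_jacobi a n1 le_cb.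
rewrite (D0 erefl) horner0 => /esym/eqP.
have -> : (-1 - 1) / -1 = 2 :> C by field.
rewrite !mulf_eq0 !expf_eq0 (negbTE n1) !andbF opprK orbF /=.
rewrite -[1 + 1]/(2%:R) pnatr_eq0 andbF /=.
by apply/negP; rewrite gt_eqF ?jacobi_sum_gt0.
Qed.

End RealRooted.

(** * Branden's theorem *)

Section Branden.

Definition lin_prod (F : comNzRingType) (s : seq F) : {poly F} :=
  \prod_(r <- s) (1 + r *: 'X).

Definition rev_lin_prod (F : comNzRingType) (s : seq F) : {poly F} :=
  \prod_(r <- s) (r%:P + 'X).

Section LinProd.
Variable F : comNzRingType.
Implicit Types (s : seq F) (p : {poly F}).

Lemma lin_prod_cons r s : lin_prod (r :: s) = lin_prod s + r *: ('X * lin_prod s).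
Proof. by rewrite /lin_prod big_cons mulrDl mul1r scalerAl. Qed.

Lemma rev_lin_prod_cons r s :
  rev_lin_prod (r :: s) = r *: rev_lin_prod s + 'X * rev_lin_prod s.
Proof. by rewrite /rev_lin_prod big_cons mulrDl mul_polyC. Qed.

Lemma coef0_lin_prod s : (lin_prod s)`_0 = 1.
Proof.
elim: s => [|r s IH]; first by rewrite /lin_prod big_nil coefC.
by rewrite lin_prod_cons coefD coefZ coefXM IH mulr0 addr0.
Qed.

Lemma size_lin_prod s : (size (lin_prod s) <= (size s).+1)%N.
Proof.
elim: s => [|r s IH]; first by rewrite /lin_prod big_nil size_poly1.
rewrite lin_prod_cons (leq_trans (size_polyD _ _)) // geq_max (leqW IH).
rewrite (leq_trans (size_scale_leq _ _)) // (leq_trans (size_polyMleq _ _)) //.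
by rewrite size_polyX.
Qed.

Lemma size_rev_lin_prod s : (size (rev_lin_prod s) <= (size s).+1)%N.
Proof.
elim: s => [|r s IH]; first by rewrite /rev_lin_prod big_nil size_poly1.
rewrite rev_lin_prod_cons (leq_trans (size_polyD _ _)) // geq_max.
rewrite (leq_trans (size_scale_leq _ _) (leqW IH)) /=.
rewrite (leq_trans (size_polyMleq _ _)) //.
by rewrite size_polyX.
Qed.

Lemma coef_rev_lin_prod s k : (k <= size s)%N ->
  (rev_lin_prod s)`_(size s - k) = (lin_prod s)`_k.
Proof.
elim: s k => [|r s IH] k /=.
  by rewrite leqn0 => /eqP->; rewrite /rev_lin_prod /lin_prod !big_nil.
rewrite rev_lin_prod_cons lin_prod_cons !coefD !coefZ !coefXM.
case: k => [_|k].
  rewrite subn0 /= mulr0 addr0 -(IH 0) // subn0 nth_default ?mulr0 ?add0r //.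
  exact: size_rev_lin_prod.
rewrite ltnS subSS leq_eqVlt => /predU1P[->|lt_ks].
  rewrite subnn /= addr0 -(IH (size s)) // subnn [in RHS]nth_default ?add0r //.
  exact: size_lin_prod.
rewrite IH 1?ltnW // subn_eq0 leqNgt lt_ks /= addrC -(IH k.+1) //.
by rewrite subnS.
Qed.

Lemma coef_lin_prod_scale (w : F) s k :
  (lin_prod [seq w * r | r <- s])`_k = w ^+ k * (lin_prod s)`_k.
Proof.
elim: s k => [|r s IH] k /=.
  by rewrite /lin_prod big_nil coefC; case: k => [|k]; rewrite ?expr0 ?mul1r ?mulr0.
rewrite !lin_prod_cons !coefD !coefZ !coefXM IH.
case: k => [|k] /=; first by rewrite !mulr0 !addr0.
by rewrite IH exprS; ring.
Qed.

Lemma lin_prod_nseq n (x : F) : lin_prod (nseq n x) = (1%:P + x *: 'X) ^+ n.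
Proof. by rewrite /lin_prod big_nseq -Monoid.iteropE. Qed.

(** The factor [('X * p)]_k[is the coefficient of index]k - 1[, with the value 0 at]k =
    0[, where natural subtraction would give]p[_0]. *)
Definition Lpoly p : {poly F} :=
  \poly_(k < size p) (p`_k ^+ 2 - ('X * p)`_k * p`_k.+1).

Lemma coef_Lpoly p k : (Lpoly p)`_k = p`_k ^+ 2 - ('X * p)`_k * p`_k.+1.
Proof.
rewrite coef_poly; case: ltnP => // le_pk.
by rewrite (nth_default _ le_pk) (nth_default _ (leqW le_pk)) expr0n mulr0 subrr.
Qed.

(** Reversal turns both sums into convolutions: the squares come from [lin_prod s * rev_lin_prod s],
    and the products of coefficients two apart from the same product times ['X^2]. *)
Lemma sum_Lpoly_lin_prod s :
  \sum_(k < (size s).+1) (Lpoly (lin_prod s))`_k =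
    ((1 - 'X^2) * (lin_prod s * rev_lin_prod s))`_(size s).
Proof.
have -> : (1 - 'X^2) * (lin_prod s * rev_lin_prod s) =
    lin_prod s * rev_lin_prod s - ('X * lin_prod s) * ('X * rev_lin_prod s).
  by ring.
rewrite coefB !coefM -sumrB; apply: eq_bigr => -[k lt_k] _ /=.
rewrite coef_Lpoly coef_rev_lin_prod // -expr2; congr (_ - _ * _).
rewrite coefXM subn_eq0; case: leqP => [le_sk|lt_ks].
  by rewrite nth_default // (leq_trans (size_lin_prod _)).
by rewrite -subnS coef_rev_lin_prod.
Qed.

(** Scaling every [r] by [w] multiplies both terms of the coefficient of index [k] by
    [w ^+ (2 * k)], so evaluation at [w ^+ 2] becomes a plain sum of coefficients. *)
Lemma horner_Lpoly_lin_prod (c w : F) s :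
  (Lpoly (c *: lin_prod s)).[w ^+ 2] = c ^+ 2 *
    ((1 - 'X^2) * (lin_prod [seq w * r | r <- s]
                   * rev_lin_prod [seq w * r | r <- s]))`_(size s).
Proof.
have := sum_Lpoly_lin_prod [seq w * r | r <- s]; rewrite size_map => <-.
rewrite (@horner_coef_wide _ (size s).+1); last first.
  rewrite (leq_trans (size_poly _ _)) // (leq_trans (size_scale_leq _ _)) //.
  exact: size_lin_prod.
rewrite mulr_sumr; apply: eq_bigr => -[k /= _] _.
rewrite !coef_Lpoly !coefXM !coefZ !coef_lin_prod_scale.
case: k => [|k] /=; first by rewrite !expr0; ring.
by rewrite ?coefZ ?coef_lin_prod_scale -exprM mulnC exprM !exprS; ring.
Qed.

End LinProd.

(** The difference is a Narayana number. For positive [k], every binomial involved is a rational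
    multiple of ['C(n, k)]. *)
Lemma narayana_bin (F : numFieldType) n k : (k <= n)%N ->
  n.+1%:R * ('C(n, k)%:R ^+ 2
             - (if k is k'.+1 then 'C(n, k')%:R else 0) * 'C(n, k.+1)%:R)
  = ('C(n.+1, k) * 'C(n.+1, k.+1))%:R :> F.
Proof.
case: k => [|k] le_kn; first by rewrite !bin0 !bin1 mul1n mul0r subr0 expr1n mulr1.
have [q Eq] : exists q, n = (k.+1 + q)%N by exists (n - k.+1)%N; rewrite subnKC.
rewrite [in 'C(n.+1, k.+1)]binS [in 'C(n.+1, k.+2)]binS.
have eA := mul_bin_left n k; have eD := mul_bin_left n k.+1.
have EA : 'C(n, k)%:R = k.+1%:R * 'C(n, k.+1)%:R / q.+1%:R :> F.
  rewrite -natrM eA Eq (_ : k.+1 + q - k = q.+1)%N; last by lia.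
  by rewrite natrM mulrC mulKf // pnatr_eq0.
have ED : 'C(n, k.+2)%:R = q%:R * 'C(n, k.+1)%:R / k.+2%:R :> F.
  rewrite -natrM (_ : q = n - k.+1)%N; last by rewrite Eq; lia.
  by rewrite -eD natrM mulrC mulKf // pnatr_eq0.
rewrite natrM !natrD EA ED Eq -[(k.+1 + q).+1]addn1 !natrD.
have := ler0n F k; have := ler0n F q.
rewrite -[q.+1]addn1 -[k.+2]addn1 -[k.+1]addn1 !natrD => q0 k0; field.
by apply/andP; split; rewrite gt_eqF // ltr_wpDl // addr_ge0.
Qed.

Variable R : rcfType.
Local Notation C := R[i].
Implicit Types (s : seq C) (p : {poly C}).

(* [Re x != 0] excludes [x ^+ 2 < 0]; the sum is a Narayana polynomial in
   [x ^+ 2]. *)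
Lemma sum_Lpoly_nseq_neq0 n (x : C) : Re x != 0 ->
  \sum_(k < n.+1) (Lpoly (lin_prod (nseq n x)))`_k != 0.
Proof.
move=> xN0.
suff E : n.+1%:R * \sum_(k < n.+1) (Lpoly (lin_prod (nseq n x)))`_k =
    jacobi_sum n.+1 n.+1 1 (x ^+ 2).
  suff : jacobi_sum n.+1 n.+1 1 (x ^+ 2) != 0.
    by rewrite -E mulf_eq0 negb_or => /andP[].
  (* If [x ^+ 2] is real then so is [x], since [Re x != 0]; the argument is then nonnegative and the
     sum positive. *)
  have [x2|] := eqVneq (Im (x ^+ 2)) 0; last exact: jacobi_sum_neq0.
  rewrite gt_eqF // jacobi_sum_gt0 //.
  case: x xN0 x2 {E} => u v /= u0 /eqP.
  rewrite [v * u]mulrC -mulr2n mulrn_eq0 mulf_eq0 (negbTE u0) /= => /eqP->.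
  by rewrite lecE /= !mul0r mulr0 addr0 subr0 eqxx -expr2 sqr_ge0.
(* [jacobi_sum] has one term more, of index [n.+1], which is zero. *)
rewrite /jacobi_sum [RHS]big_ord_recr /= add1n (bin_small (ltnSn n.+1)).
rewrite muln0 mulr0n addr0 mulr_sumr; apply: eq_bigr => -[k lt_k] _ /=.
rewrite add1n -[RHS]mulr_natr -narayana_bin // coef_Lpoly lin_prod_nseq coefXM.
rewrite !coef_exp_XaddC !expr1n.
case: k lt_k => [|k] _; first by rewrite /= !expr0; ring.
by rewrite /= ?expr1n [x ^+ 2 ^+ _]exprAC !exprS; ring.
Qed.

(** Each factor [(1 + r X) (r + X) = r (1 + X^2) + (r^2 + 1) X] is palindromic, hence affine in the
    single parameter [(r + r^-1)^-1] after normalization: the shape needed for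
    [grace_walsh_szego]. *)
Lemma lin_prod_mul_rev (s : seq C) : (forall r, r \in s -> r != 0) ->
  (forall r, r \in s -> r + r^-1 != 0) ->
  lin_prod s * rev_lin_prod s = (\prod_(r <- s) (r * (r + r^-1))) *:
    \prod_(z <- [seq (r + r^-1)^-1 | r <- s]) ('X + z *: (1 + 'X^2)).
Proof.
move=> sN0 sN1; rewrite big_map -scaler_prod /lin_prod /rev_lin_prod -big_split.
rewrite /= !big_seq; apply: eq_bigr => r rs.
rewrite scalerDr scalerA mulfK ?sN1 //.
have -> : r * (r + r^-1) = r * r + 1 by rewrite mulrDr mulfV ?sN0.
by rewrite -!mul_polyC polyCD polyCM polyC1; ring.
Qed.

Lemma central_coef_lin_prod_neq0 (s : seq C) : (forall r, r \in s -> 0 < Re r) ->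
  ((1 - 'X^2) * (lin_prod s * rev_lin_prod s))`_(size s) != 0.
Proof.
move=> s_gt0.
have sN0 r : r \in s -> r != 0 by move=> /s_gt0 h; rewrite Re_neq0 // gt_eqF.
have s1_gt0 r : r \in s -> 0 < Re (r + r^-1).
  by move=> /s_gt0 h; rewrite Re_add addr_gt0 // Re_inv_gt0.
have sN1 r : r \in s -> r + r^-1 != 0.
  by move=> /s1_gt0 h; rewrite Re_neq0 // gt_eqF.
rewrite lin_prod_mul_rev // -scalerAr coefZ mulf_neq0 //.
  rewrite prodf_seq_neq0; apply/allP => r rs /=.
  exact: mulf_neq0 (sN0 r rs) (sN1 r rs).
apply: grace_walsh_szego => [z z_gt0|z /mapP[r rs ->]]; last first.
  by rewrite Re_inv_gt0 // s1_gt0.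
rewrite size_map; set n := size s.
have z0 : z != 0 by rewrite Re_neq0 // gt_eqF.
(* Undoing the change of parameter at the diagonal point [z] leads back to [n] equal factors; [x] is
   a root of [x^2 - x / z + 1]. *)
have [x [x0 Ex]] : exists x : C, x != 0 /\ x + x^-1 = z^-1.
  pose d := sqrtc (z^-1 ^+ 2 - 4).
  have d2 : d ^+ 2 = z^-1 ^+ 2 - 4 := sqr_sqrtc _.
  pose x := (z^-1 + d) / 2.
  have x2 : x ^+ 2 + 1 = z^-1 * x.
    have -> : x ^+ 2 + 1 = (z^-1 ^+ 2 + 2 * z^-1 * d + d ^+ 2 + 4) / 4.
      by rewrite /x; field.
    by rewrite d2 /x; field.
  have x0 : x != 0.
    by apply: contra_eq_neq x2 => ->; rewrite expr0n add0r mulr0 oner_eq0.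
  exists x; split => //; apply: (mulIf x0); rewrite mulrDl mulVf // -x2.
have zi : 0 < Re (x + x^-1) by rewrite Ex Re_inv_gt0.
(* For purely imaginary [x], the sum [x + x^-1] would be purely imaginary too. *)
have Rx : Re x != 0.
  apply: contraTneq zi => Rx0.
  by rewrite Re_add Re_inv Rx0 mul0r addr0 ltxx.
have := sum_Lpoly_nseq_neq0 n Rx.
have := sum_Lpoly_lin_prod (nseq n x); rewrite size_nseq => ->.
rewrite lin_prod_mul_rev; first last.
- by move=> r; rewrite mem_nseq => /andP[_ /eqP->]; rewrite Ex invr_eq0.
- by move=> r; rewrite mem_nseq => /andP[_ /eqP->].
rewrite map_nseq Ex invrK [X in _ *: X]big_nseq -Monoid.iteropE.
rewrite -scalerAr coefZ mulf_eq0 negb_or => /andP[_].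
by [].
Qed.

(** Polynomials with positive constant term and only negative real zeros; in the order of [R[i]],
    positivity includes being real. *)
Definition pos_split p := exists (c : C) s,
  [/\ 0 < c, forall r, r \in s -> 0 < r & p = c *: lin_prod s].

(** Squares of the right half-plane fill the plane slit along the nonpositive reals, and the
    constant term excludes the root 0. *)
Lemma pos_splitP p : 0 < p`_0 -> (forall w : C, 0 < Re w -> p.[w ^+ 2] != 0) ->
  pos_split p.
Proof.
move=> p0_gt0 pN0.
have [s Ep] := closed_field_poly_normal p.
have p0 : p != 0 by apply: contraTneq p0_gt0 => ->; rewrite coef0 ltxx.
have s_root z : z \in s -> p.[z] = 0.
  move=> zs; apply/eqP; rewrite Ep hornerZ mulf_eq0.
  by apply/orP; right; rewrite -/(root _ _) root_prod_XsubC.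
have s_lt0 z : z \in s -> z < 0.
  move=> /s_root pz.
  have zN0 : z != 0.
    by apply: contraTneq p0_gt0 => z0; rewrite -horner_coef0;
      rewrite z0 in pz; rewrite pz ltxx.
  have Ez := sqr_sqrtc z; set w := sqrtc z in Ez.
  (* Both [w] and [- w] are square roots of [z], and neither may lie in the right half-plane. *)
  have Rw : Re w = 0.
    apply/eqP; rewrite eq_le !leNgt; apply/andP; split; apply/negP => hw.
      by have := pN0 w hw; rewrite Ez pz eqxx.
    by have := pN0 (- w); rewrite Re_opp oppr_gt0 sqrrN Ez pz eqxx => /(_ hw).
  have wN0 : Im w != 0.
    by apply: contraNneq zN0 => Iw; rewrite -Ez; case: w Rw Iw {Ez} => /= ? ? -> ->;
      rewrite expr0n.
  rewrite -Ez; case: w Rw wN0 {Ez} => u v /= -> v0.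
  by rewrite ltcE /= !mul0r mulr0 addr0 eqxx sub0r oppr_lt0 -expr2
    exprn_even_gt0.
pose t := [seq - z^-1 | z <- s].
have Et : p = p`_0 *: lin_prod t.
  have E : \prod_(z <- s) ('X - z%:P) = (\prod_(z <- s) - z) *: lin_prod t.
    rewrite /lin_prod big_map -scaler_prod !big_seq; apply: eq_bigr => z zs.
    rewrite scalerDr scalerA mulrNN mulfV ?scale1r; last by rewrite lt_eqF ?s_lt0.
    by rewrite -mul_polyC mulr1 polyCN addrC.
  pose K := lead_coef p * \prod_(z <- s) - z.
  have EK : p = K *: lin_prod t by rewrite {1}Ep E scalerA.
  by rewrite {2}EK coefZ coef0_lin_prod mulr1.
exists p`_0, t; split=> // _ /mapP[z /s_lt0 z0 ->].
by rewrite oppr_gt0 invr_lt0.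
Qed.

Lemma pos_split_coef_ge0 p k : pos_split p -> 0 <= p`_k.
Proof.
move=> [c [s [c_gt0 s_gt0 ->]]]; rewrite coefZ mulr_ge0 ?(ltW c_gt0) //.
elim: s s_gt0 k => [|r s IH] s_gt0 k.
  by rewrite /lin_prod big_nil coef1 ler0n.
have {}IH k' : 0 <= (lin_prod s)`_k'.
  by apply: IH => x xs; rewrite s_gt0 // in_cons xs orbT.
rewrite lin_prod_cons coefD coefZ coefXM addr_ge0 // mulr_ge0 //.
  by rewrite ltW // s_gt0 // mem_head.
by case: ifP.
Qed.

Theorem branden p : pos_split p -> pos_split (Lpoly p).
Proof.
move=> [c [s [c_gt0 s_gt0 ->]]]; apply: pos_splitP => [|w w_gt0].
  rewrite coef_Lpoly coefXM /= mul0r subr0 coefZ coef0_lin_prod mulr1.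
  exact: exprn_gt0.
rewrite horner_Lpoly_lin_prod mulf_neq0 ?expf_neq0 ?(gt_eqF c_gt0) //.
rewrite -(size_map (fun r => w * r)).
apply: central_coef_lin_prod_neq0 => _ /mapP[r /s_gt0 r_gt0 ->].
move: r_gt0; rewrite ltcE /= => /andP[/eqP r0 r_gt0].
by rewrite Re_mul r0 mulr0 subr0 mulr_gt0.
Qed.

End Branden.

(** * The cubic behind the higher order Turan inequality *)

Section Turan.
Variable R : rcfType.
Local Notation C := R[i].

(** This presents the cubic at [x] as one coefficient of a product, the form to which
    [grace_walsh_szego] applies. *)
Lemma coef_XaddC_cubed_mul (F : comNzRingType) (x : F) (q : {poly F}) e :
  (('X + x%:P) ^+ 3 * q)`_e.+3 =
    q`_e + 3 * x * q`_e.+1 + 3 * x ^+ 2 * q`_e.+2 + x ^+ 3 * q`_e.+3.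
Proof.
have -> : ('X + x%:P) ^+ 3 * q = 'X * ('X * ('X * q)) +
    (3 * x)%:P * ('X * ('X * q)) + (3 * x ^+ 2)%:P * ('X * q) + (x ^+ 3)%:P * q.
  by rewrite !polyCM !polyC_natr; ring.
by rewrite !coefD !coefCM !coefXM.
Qed.

Lemma turan_cubic_neq0 (s : seq C) e (x : C) :
  (forall r, r \in s -> 0 < r) -> (e <= size s)%N -> Im x != 0 ->
  (('X + x%:P) ^+ 3 * lin_prod s)`_e.+3 != 0.
Proof.
move=> s_gt0 le_es xN0.
have x0 : x != 0 := Im_neq0 xN0.
(* [kappa] has real part 1, so the points [kappa * r] lie in the right half-plane. On the diagonal
   the argument of [jacobi_sum] becomes [z * y], which is not real because [y] is imaginary and
   [Re z > 0]. *)
pose y : C := (0 +i* Im x)%C; pose kappa := x / y.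
have y0 : y != 0 by apply: Im_neq0.
have k0 : kappa != 0 by rewrite mulf_neq0 ?invr_eq0.
have Rk : 0 < Re kappa.
  rewrite /kappa Re_mul Re_inv Im_inv /= mul0r mulr0 sub0r mulrN opprK.
  by rewrite expr0n add0r mulrA -expr2 divff ?expf_neq0.
have -> : lin_prod s =
    \prod_(z <- [seq kappa * r | r <- s]) (1 + z *: (kappa^-1 *: 'X)).
  rewrite big_map; apply: eq_bigr => r _.
  by rewrite scalerA mulrAC mulfV // mul1r.
apply: grace_walsh_szego => [z z_gt0|_ /mapP[r /s_gt0 r_gt0 ->]]; last first.
  move: r_gt0; rewrite ltcE /= => /andP[/eqP r0 r_gt0].
  by rewrite Re_mul r0 mulr0 subr0 mulr_gt0.
rewrite size_map scalerA; set rho := z / kappa; set n := size s.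
have z0 : z != 0 by rewrite Re_neq0 // gt_eqF.
have rho0 : rho != 0 by rewrite mulf_neq0 ?invr_eq0.
have xrho : x * rho = z * y by rewrite /rho /kappa; field; rewrite x0 y0.
have : rho ^+ e * jacobi_sum 3 n e (x * rho) != 0.
  rewrite mulf_neq0 ?expf_neq0 // jacobi_sum_neq0 // xrho Im_mul /= mulr0 addr0.
  by rewrite mulf_neq0 // gt_eqF.
congr (_ != 0); rewrite coef_XaddC_cubed_mul -polyC1 !coef_exp_XaddC !expr1n.
rewrite /jacobi_sum !big_ord_recl big_ord0 /= /bump /= !add1n addn0 addn1 addn2 addn3.
rewrite (_ : 'C(3, 1) = 3%N) // (_ : 'C(3, 2) = 3%N) // (_ : 'C(3, 3) = 1%N) // bin0.
have [N NE] : exists N : nat -> C, forall k u, u *+ k = u * N k.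
  by exists (fun k => k%:R) => k u; rewrite mulr_natr.
rewrite !mul1n !mulrnA !(NE 'C(_, _)); move: (rho) => u. rewrite !exprS !expr0; ring.
Qed.

(** The difference of the two sides is 1/27 of the discriminant of [a + 3 b X + 3 c X^2 + d X^3],
    whose roots are the [r_i] by Vieta's formulas. *)
Lemma turan_of_real_roots (F : numFieldType) (a b c d r1 r2 r3 : F) :
  d \is Num.real -> r1 \is Num.real -> r2 \is Num.real -> r3 \is Num.real ->
  a = - d * (r1 * r2 * r3) -> 3 * b = d * (r1 * r2 + r1 * r3 + r2 * r3) ->
  3 * c = - d * (r1 + r2 + r3) ->
  (b * c - a * d) ^+ 2 <= 4 * (b ^+ 2 - a * c) * (c ^+ 2 - b * d).
Proof.
move=> rd rr1 rr2 rr3 -> Eb Ec; rewrite -subr_ge0.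
have -> : 4 * (b ^+ 2 - - d * (r1 * r2 * r3) * c) * (c ^+ 2 - b * d)
    - (b * c - - d * (r1 * r2 * r3) * d) ^+ 2 = (d ^+ 2 * ((r1 - r2) * (r1 - r3) * (r2 - r3))) ^+ 2 / 27.
  have -> : b = d * (r1 * r2 + r1 * r3 + r2 * r3) / 3 by rewrite -Eb; field.
  have -> : c = - d * (r1 + r2 + r3) / 3 by rewrite -Ec; field.
  by field.
rewrite divr_ge0 // real_exprn_even_ge0 // !rpredM ?rpredB //.
Qed.

Theorem pos_split_turan (p : {poly C}) e : pos_split p -> p`_e.+3 != 0 ->
  (p`_e.+1 * p`_e.+2 - p`_e * p`_e.+3) ^+ 2 <=
    4 * (p`_e.+1 ^+ 2 - p`_e * p`_e.+2) * (p`_e.+2 ^+ 2 - p`_e.+1 * p`_e.+3).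
Proof.
move=> p_split d0; have [k [s [k_gt0 s_gt0 Ep]]] := p_split.
(* The nonzero coefficient of index [e.+3] bounds [e] by the degree; it also makes [q] below a
   genuine cubic with three roots. *)
have le_es : (e <= size s)%N.
  apply: contraNT d0; rewrite -ltnNge Ep coefZ => lt_se.
  by rewrite nth_default ?mulr0 // (leq_trans (size_lin_prod _)) // !leqW.
pose a := p`_e; pose b := p`_e.+1; pose c := p`_e.+2; pose d := p`_e.+3.
pose q : {poly C} := a%:P + (3 * b)%:P * 'X + (3 * c)%:P * 'X^2 + d%:P * 'X^3.
have q_neq0 x : Im x != 0 -> q.[x] != 0.
  move=> /(turan_cubic_neq0 s_gt0 le_es) h.
  suff -> : q.[x] = k * (('X + x%:P) ^+ 3 * lin_prod s)`_e.+3.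
    by rewrite mulf_neq0 // gt_eqF.
  rewrite -coefZ scalerAr -Ep coef_XaddC_cubed_mul /q.
  rewrite !(hornerD, hornerCM, hornerC, hornerX, hornerXn).
  by rewrite -/a -/b -/c -/d; ring.
have Eq i : q`_i = (a%:P`_i + 3 * b * (i == 1)%:R + 3 * c * (i == 2)%:R
   + d * (i == 3)%:R).
  by rewrite !coefD !coefCM coefX !coefXn.
have size_q : size q = 4.
  apply/eqP; rewrite eqn_leq; apply/andP; split.
    apply/leq_sizeP => -[|[|[|[|j]]]] // _.
    by rewrite Eq coefC /= !mulr0 !addr0.
  rewrite ltnNge; apply: contra d0 => /leq_sizeP/(_ 3 (leqnn _)).
  by rewrite Eq coefC /= !mulr0 !add0r mulr1 => /eqP.
have [t Et] := closed_field_poly_normal q.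
have lead_q : lead_coef q = d.
  by rewrite lead_coefE size_q Eq coefC /= !mulr0 !add0r mulr1.
rewrite lead_q in Et.
have t_real x : x \in t -> x \is Num.real.
  move=> xt; case: x xt => u v xt; rewrite complex_real.
  apply/negPn/negP => /(q_neq0 (u +i* v)%C)/negP; apply; rewrite Et hornerZ mulf_eq0.
  by apply/orP; right; rewrite -/(root _ _) root_prod_XsubC.
have := congr1 (size \o polyseq) Et.
rewrite /= size_q size_scale // size_prod_XsubC => -[size_t].
case: t Et t_real size_t => [|r1 [|r2 [|r3 [|]]]] // Et t_real _.
have {}Et : q = (- d * (r1 * r2 * r3))%:P
    + (d * (r1 * r2 + r1 * r3 + r2 * r3))%:P * 'X
    + (- d * (r1 + r2 + r3))%:P * 'X^2 + d%:P * 'X^3.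
  rewrite Et !big_cons big_nil -mul_polyC !(polyCM, polyCD, polyCN); ring.
have Eq' i : q`_i = ((- d * (r1 * r2 * r3))%:P`_i
    + (d * (r1 * r2 + r1 * r3 + r2 * r3)) * (i == 1)%:R
    + (- d * (r1 + r2 + r3)) * (i == 2)%:R + d * (i == 3)%:R).
  by rewrite Et !coefD !coefCM coefX !coefXn.
have Ea : a = - d * (r1 * r2 * r3).
  by have := Eq 0; rewrite Eq' !coefC /= !mulr0 !addr0.
have Eb : 3 * b = d * (r1 * r2 + r1 * r3 + r2 * r3).
  by have := Eq 1; rewrite Eq' !coefC /= !mulr0 !mulr1 !addr0 !add0r.
have Ec : 3 * c = - d * (r1 + r2 + r3).
  by have := Eq 2; rewrite Eq' !coefC /= !mulr0 !mulr1 !addr0 !add0r.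
rewrite -/a -/b -/c -/d; apply: turan_of_real_roots Ea Eb Ec.
- by apply: ger0_real; apply: pos_split_coef_ge0.
- by apply: t_real; rewrite !inE eqxx.
- by apply: t_real; rewrite !inE eqxx orbT.
- by apply: t_real; rewrite !inE eqxx !orbT.
Qed.

End Turan.

(** * The polynomials with coefficients [g1] *)

Section Delannoy.

(** The coefficients are the Delannoy numbers D(k, m - k). Where [m - j.*2] is truncated, the
    binomial is zero. *)
Definition delannoy_poly (F : comNzRingType) m : {poly F} :=
  \sum_(0 <= j < m.+1) 'X^j * (1 + 'X) ^+ (m - j.*2) *+ 'C(m - j, j).

Lemma delannoy_polyS (F : comNzRingType) m : delannoy_poly F m.+2 =
  (1 + 'X) * delannoy_poly F m.+1 + 'X * delannoy_poly F m.
Proof.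
pose T n j : {poly F} := 'X^j * (1 + 'X) ^+ (n - j.*2) *+ 'C(n - j, j).
(* Pascal's rule splits [T m.+2]: the part [U] sums to the first term of the recurrence, the
   remainder to the second. *)
pose U j : {poly F} := 'X^j * (1 + 'X) ^+ (m.+2 - j.*2) *+ 'C(m.+1 - j, j).
have TS j : T m.+2 j.+1 = U j.+1 + 'X * T m j.
  rewrite /T /U (_ : m.+2 - j.+1.*2 = m - j.*2)%N; last by lia.
  rewrite mulrnAr mulrA -exprS; have [le_jm|lt_mj] := leqP j m.
    by rewrite (_ : m.+2 - j.+1 = (m - j).+1)%N ?binS ?mulrnDr //; lia.
  by rewrite !bin_small ?mulr0n ?addr0 //; lia.
have UE j : U j = (1 + 'X) * T m.+1 j.
  rewrite /U /T; have [lt_mj|le_jm] := ltnP (m.+1 - j) j.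
    by rewrite bin_small // !mulr0n mulr0.
  rewrite (_ : m.+2 - j.*2 = (m.+1 - j.*2).+1)%N; last by lia.
  by rewrite exprS mulrnAr mulrCA.
rewrite -[LHS]/(\sum_(0 <= j < m.+3) T m.+2 j).
rewrite -[delannoy_poly F m.+1]/(\sum_(0 <= j < m.+2) T m.+1 j).
rewrite -[delannoy_poly F m]/(\sum_(0 <= j < m.+1) T m j) !mulr_sumr.
rewrite big_nat_recl // (eq_bigr _ (fun j _ => TS j)) big_split /= addrA.
congr (_ + _); last first.
  have T0 : T m m.+1 = 0 by rewrite /T bin_small ?mulr0n //; lia.
  by rewrite big_nat_recr //= T0 mulr0 addr0.
have U0 : U m.+2 = 0 by rewrite /U bin_small ?mulr0n //; lia.
rewrite -(eq_bigr _ (fun j _ => UE j)) big_nat_recr //= U0 addr0.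
by rewrite [RHS]big_nat_recl.
Qed.

Lemma bin_bin_sym n a b : (a + b <= n)%N ->
  ('C(n, a) * 'C(n - a, b) = 'C(n, b) * 'C(n - b, a))%N.
Proof.
move=> le_abn; apply/eqP.
have pos : (0 < a`! * (b`! * (n - a - b)`!))%N by rewrite !muln_gt0 !fact_gt0.
rewrite -(eqn_pmul2r pos); apply/eqP.
have e1 := @bin_fact n a (leq_trans (leq_addr _ _) le_abn).
have e2 : _ := @bin_fact (n - a) b ltac:(lia).
have e3 := @bin_fact n b (leq_trans (leq_addl _ _) le_abn).
have e4 : _ := @bin_fact (n - b) a ltac:(lia).
rewrite (_ : n - b - a = n - a - b)%N in e4; last by lia.
transitivity n`!; first by rewrite -e1 -e2; ring.
by rewrite -e3 -e4; ring.
Qed.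

(** With [i = j.+1], the [j]-th term contributes ['C(m - j, j) * 'C(m - j.*2, k - j)], a trinomial
    coefficient that [bin_bin_sym] rewrites as the summand of [g1]. *)
Lemma coef_delannoy_poly (F : comNzRingType) m k : (k <= m)%N ->
  (delannoy_poly F m)`_k = (g1 m.+2 k.+1)%:R.
Proof.
move=> le_km; rewrite /g1 big_add1 /= coef_sum natr_sum.
have -> : minn k.+1 (m.+2 - k.+1) = (minn k (m - k)).+1 by lia.
have le_min : ((minn k (m - k)).+1 <= m.+1)%N by lia.
(* Beyond [minn k (m - k)] either [j > k] or one of the two binomials is zero. *)
rewrite (big_cat_nat _ le_min) //= [X in _ + X = _]big_nat_cond.
rewrite [X in _ + X = _]big1 ?addr0 => [|j].
  rewrite !big_nat; apply: eq_bigr => j lt_j.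
  have -> : (m.+2 - j.+1 - 1 = m - j)%N by lia.
  have -> : (k.+1 - j.+1 = k - j)%N by lia.
  have -> : (m.+2 - k.+1 - 1 = m - k)%N by lia.
  rewrite (_ : m - k = m - j - (k - j))%N; last by lia.
  rewrite bin_bin_sym; last by lia.
  rewrite coefMn coefXnM ltnNge (_ : j <= k)%N /=; last by lia.
  rewrite -polyC1 -['X]scale1r coef_exp_XaddC !expr1n mulr1 mulnC.
  rewrite subn1 /= (_ : m - j - j = m - j.*2)%N; last by lia.
  by rewrite natrM mulr_natr.
rewrite andbT => /andP[lt_j _]; rewrite coefMn coefXnM.
case: ltnP => [_|le_jk]; first by rewrite mul0rn.
rewrite -polyC1 -['X]scale1r coef_exp_XaddC !expr1n mulr1 -mulrnA.
have [lt_m2j|le_2jm] := ltnP m j.*2.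
  by rewrite [X in (_ * X)%N]bin_small ?muln0 //; lia.
by rewrite bin_small //; lia.
Qed.

Lemma size_delannoy_poly (F : comNzRingType) m :
  (size (delannoy_poly F m) <= m.+1)%N.
Proof.
apply/leq_sizeP => k lt_mk; rewrite coef_sum big1_seq // => j.
rewrite mem_index_iota /= => lt_j.
rewrite coefMn coefXnM -polyC1 -['X]scale1r coef_exp_XaddC.
case: ltnP => [_|le_jk]; first by rewrite mul0rn.
have [lt_m2j|le_2jm] := ltnP m j.*2.
  by rewrite ['C(m - j, j)]bin_small ?mulr0n //; lia.
by rewrite bin_small ?mulr0n ?mul0rn //; lia.
Qed.

Lemma g1_gt0 m k : (k <= m)%N -> (0 < g1 m.+2 k.+1)%N.
Proof.
move=> le_km; rewrite /g1 big_ltn; last by lia.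
by rewrite subnn bin0 muln1 ltn_addr // bin_gt0; lia.
Qed.

Variable R : rcfType.
Local Notation C := R[i].

Lemma delannoy_poly_neq0 m (w : C) : 0 < Re w ->
  (delannoy_poly C m).[w ^+ 2] != 0.
Proof.
move=> w_gt0; pose v k := (delannoy_poly C k).[w ^+ 2].
have w0 : w != 0 by rewrite Re_neq0 // gt_eqF.
have c_gt0 : 0 < Re (w + w^-1) by rewrite Re_add addr_gt0 ?Re_inv_gt0.
(* Divided by [w * v m.+1], the recurrence says that each ratio is [w + w^-1] plus the inverse of
   the previous one, and the right half-plane is stable under sums and inverses. *)
suff : v m != 0 /\ 0 < Re (v m.+1 / (w * v m)) by case.
elim: m => [|m [vN0 IH]].
  have v0 : v 0 = 1.
    by rewrite /v /delannoy_poly big_nat1 bin0 !expr0 mul1r mulr1n hornerC.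
  have v1 : v 1 = 1 + w ^+ 2.
    rewrite /v /delannoy_poly !big_nat_recr // big_nil /= /= bin0 mulr1n.
    by rewrite mulr0n addr0 add0r expr0 expr1 mul1r !hornerE.
  rewrite v0 oner_neq0 v1; split=> //.
  by rewrite (_ : _ / _ = w + w^-1) //; field.
have vS0 : v m.+1 != 0.
  by apply: contraTneq IH => ->; rewrite mul0r ltxx.
split=> //.
have -> : v m.+2 = (1 + w ^+ 2) * v m.+1 + w ^+ 2 * v m.
  by rewrite /v delannoy_polyS !hornerE.
rewrite (_ : _ / _ = (w + w^-1) + (v m.+1 / (w * v m))^-1).
  by rewrite Re_add addr_gt0 ?Re_inv_gt0.
by field; rewrite w0 vS0 vN0.
Qed.

Lemma pos_split_delannoy m : pos_split (delannoy_poly C m).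
Proof.
apply: pos_splitP => [|w]; last exact: delannoy_poly_neq0.
by rewrite coef_delannoy_poly // ltr0n g1_gt0.
Qed.

End Delannoy.

(** * From polynomials back to sequences *)

(* The index shift by one matches the range [1 <= d <= n - 1]. *)
Definition coef_seq (R : realType) (a : int -> R) (p : {poly R[i]}) :=
  forall k : int, (a k)%:C%C = if k is Posz m.+1 then p`_m else 0.

Lemma coef_seq_Lop (R : realType) (a : int -> R) p :
  coef_seq a p -> coef_seq (Lop a) (Lpoly p).
Proof.
move=> ap k; rewrite /Lop rmorphB rmorphXn rmorphM /= !ap.
case: k => [[|m]|m] /=.
- by rewrite expr0n /= mul0r subr0.
- by rewrite coef_Lpoly coefXM subn1 addn1; case: m.
- by rewrite expr0n /= mul0r subr0.
Qed.

Lemma inf_log_concave_pos_split (R : realType) (a : int -> R) p :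
  coef_seq a p -> pos_split p -> inf_log_concave a.
Proof.
move=> ap p_split j k _.
have [q [aq q_split]] : exists q, coef_seq (iter j (@Lop R) a) q /\ pos_split q.
  elim: j => [|j [q [aq q_split]]]; first by exists p.
  by exists (Lpoly q); split; [apply: coef_seq_Lop | apply: branden].
rewrite -ler0c aq; case: k => [[|m]|m] //.
exact: pos_split_coef_ge0.
Qed.

Theorem theorem5p2 (R : realType) (n : nat) :
  let a := fun d : nat => (g1 n d)%:R : R in
  ((4 <= n)%N -> inf_log_concave (zero_ext 1 (n - 1) a)) /\
  ((5 <= n)%N -> forall d : nat, (2 <= d <= n - 3)%N ->
     4 * (a d ^+ 2 - a (d - 1)%N * a (d + 1)%N)
       * (a (d + 1)%N ^+ 2 - a d * a (d + 2)%N)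
     >= (a d * a (d + 1)%N - a (d - 1)%N * a (d + 2)%N) ^+ 2).
Proof.
move=> a; split=> [n_ge4|n_ge5 d d_in].
  have [m En] : exists m, n = m.+2 by exists n.-2; lia.
  apply: (@inf_log_concave_pos_split _ _ (delannoy_poly _ m)).
    case=> [[|k]|k] //=; rewrite En subn1 /= ltnS.
    have [le_km|lt_mk] := leqP k m.
      by rewrite coef_delannoy_poly // rmorph_nat En.
    by rewrite nth_default // (leq_trans (size_delannoy_poly _ _)).
  exact: pos_split_delannoy.
have [m En] : exists m, n = m.+2 by exists n.-2; lia.
have [e Ed] : exists e, d = e.+2 by exists d.-2; lia.
(* The real inequality is transported to [R[i]]; with [d = e.+2], the terms of index [d - 1] to
   [d + 2] are the coefficients [e] to [e.+3]. *)
have aC k : (k <= m)%N -> (a k.+1)%:C%C = (delannoy_poly R[i] m)`_k.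
  by move=> le_km; rewrite coef_delannoy_poly // rmorph_nat En.
rewrite Ed addn1 addn2 subn1 /=.
rewrite -lecR !(rmorphXn, rmorphM, rmorphB) /= (rmorph_nat _ 4) !aC; try lia.
apply: pos_split_turan; first exact: pos_split_delannoy.
rewrite coef_delannoy_poly; last by lia.
by rewrite pnatr_eq0 -lt0n g1_gt0 //; lia.
Qed.
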